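(* Let $N(f)$ denote the number of distinct monomials appearing (with nonzero coefficient) in a polynomial $f$. (1) Let $m\ge 2$ and let $\eta$ be a primitive $m$-th root of unity. Call a real polynomial $f(x)$ in one variable special if $f(\eta x)=f(x)$ identically (equivalently, every monomial $x^a$ of $f$ has $m\mid a$), $f(1)=1$, all coefficients of $f$ are non-negative, and $f(0)=0$. Then the set of values of $N(f)$ over all special $f$ is exactly the set of all positive integers. (2) Let $r\ge 1$ be an integer and let $\eta$ be a primitive $(2r+1)$-th root of unity. Call a real polynomial $f(x,y)$ special if $f(\eta x,\eta^2 y)=f(x,y)$ identically (equivalently, every monomial $x^ay^b$ of $f$ satisfies $a+2b\equiv 0 \pmod{2r+1}$), $f(x,y)=1$ on the line $x+y=1$, all coefficients of $f$ are non-negative, and $f(0,0)=0$. Then the number $N(f)$ of terms of a special $f$ is either $r+2$ or an integer at least $2r+3$; moreover, each of the values $r+2$ and every integer $\ge 2r+3$ is attained by some special $f$.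
   Context: ''Has non-negative coefficients'' means all coefficients are $\ge 0$. *)

(* Defs.v *)
From HB Require Import structures.
From mathcomp Require Import all_boot all_order all_algebra.
From mathcomp Require Import Rstruct.
From mathcomp.real_closed Require Import complex.
From mathcomp.multinomials Require Import mpoly.

Set Implicit Arguments.
Unset Strict Implicit.
Unset Printing Implicit Defensive.

Import Order.TTheory GRing.Theory Num.Theory.
Local Open Scope ring_scope.

Notation RR := Rdefinitions.R.
Notation CC := (complex RR).

Definition polyC1 (f : {poly RR}) : {poly CC} := map_poly (real_complex RR) f.
Definition polyC2 (f : {mpoly RR[2]}) : {mpoly CC[2]} :=
  map_mpoly (real_complex RR) f.

Definition N1 (f : {poly RR}) : nat := count (fun c => c != 0) f.
Definition N2 (f : {mpoly RR[2]}) : nat := size (msupp f).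

Definition pt2 (T : Type) (x y : T) : 'I_2 -> T :=
  fun i => if val i == 0%N then x else y.

Definition special1 (eta : CC) (f : {poly RR}) : Prop :=
  [/\ (forall z : CC, (polyC1 f).[eta * z] = (polyC1 f).[z]),
      f.[1] = 1,
      (forall i : nat, 0 <= f`_i) &
      f.[0] = 0].

Definition special2 (eta : CC) (f : {mpoly RR[2]}) : Prop :=
  [/\ (forall x y : CC,
         (polyC2 f).@[pt2 (eta * x) (eta ^+ 2 * y)] = (polyC2 f).@[pt2 x y]),
      (forall x y : RR, x + y = 1 -> f.@[pt2 x y] = 1),
      (forall mon : 'X_{1..2}, 0 <= f@_mon) &
      f.@[pt2 0 0] = 0].

(* Main.v *)
Require Import Defs.
From HB Require Import structures.
From mathcomp Require Import all_boot all_order all_algebra.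
From mathcomp Require Import Rstruct.
From mathcomp.real_closed Require Import complex polyrcf.
From mathcomp.multinomials Require Import mpoly.
From mathcomp Require Import zify ring lra.
Set Implicit Arguments.
Unset Strict Implicit.
Unset Printing Implicit Defensive.
Import Order.TTheory GRing.Theory Num.Theory.
Local Open Scope ring_scope.

(** Let d = 2r+1 and f = sum_a x^a F_a(y).  On x + y = 1 one has
    f - 1 = (x + y - 1) q, that is, q_a = F_(a+1) + (1 - y) q_(a+1).
    Multiplication by 1 - y creates no new coincidence of the signs of
    (-1)^i q_(a,i), and each term of F_(a+1) changes at most two of them,
    while q_0 = (1 - F_0) / (1 - y) has positive coefficients below the degree
    of F_0; hence deg F_0 + 1 <= 2 sum_(a > 0) #F_a.  As deg F_0 is a multiple
    of d, either it is at least 2d and N(f) >= 2r+3, or F_0 = y^d.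

    In the latter case put g(x) = f(x, 1).  By invariance, g(v^-1 - v) =
    f(1 - v^2, v^2) = 1 whenever v^d = 1, so that the even and the odd parts of
    g - 1, as polynomials in x^2, both vanish at r distinct negative numbers;
    by Descartes' rule each of them is 0 or has at least r+1 terms.  The odd part
    is not 0, because f(-1, 2) = 1 < f(0, 2).  If the even part is not 0 either, then
    N(f) >= 1 + 2(r+1).  If it is 0, then the odd part of f takes on the line
    y = 1 + x the value (1 + x)^d - 1, so its terms have degree at most d, hence
    weight a + 2b = d, and N(f) = r+2.

    The value r+2 is attained by Phi = L_d(x, y) + y^d with L the Lucas
    polynomials.  Replacing a part Q of f by Q * Phi gives the other values. *)

Definition nterms (R : nzSemiRingType) (p : {poly R}) : nat :=
  count (fun c => c != 0) p.

(** * Terms and negative roots *)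

Section Terms.
Variable R : nzRingType.
Implicit Type p : {poly R}.

Lemma nterms_sum p K : (size p <= K)%N ->
  nterms p = (\sum_(0 <= i < K) (p`_i != 0)%R)%N.
Proof.
move=> le_pK; rewrite (big_cat_nat (n := size p)) //= [X in (_ + X)%N]big_nat_cond.
rewrite [X in (_ + X)%N]big1 ?addn0 => [|i /andP[/andP[le_pi _] _]]; last first.
  by rewrite nth_default // eqxx.
by rewrite /nterms -sum1_count (big_nth 0) big_mkcond; apply: eq_bigr => i _; case: eqP.
Qed.

Lemma nterms_gt0 p : (0 < nterms p)%N = (p != 0).
Proof.
rewrite /nterms -has_count; apply/hasP/idP => [[c p_c nz_c]|nz_p].
  by apply: contraTneq p_c => ->; rewrite polyseq0.
by exists (lead_coef p); rewrite ?lead_coef_eq0 // lead_coefE mem_nth // prednK ?size_poly_gt0.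
Qed.

Lemma nterms_addXn p c k : c != 0 -> p`_k = 0 ->
  nterms (p + c *: 'X^k) = (nterms p).+1.
Proof.
move=> nz_c pk0.
have [K le_pK lt_kK]: exists2 K, (size p <= K)%N & (k < K)%N.
  by exists (maxn (size p) k.+1); rewrite ?leq_maxl ?leq_maxr.
have sz : (size (p + c *: 'X^k)%R <= K)%N.
  apply: leq_trans (size_polyD _ _) _; rewrite geq_max le_pK /=.
  by apply: leq_trans (size_scale_leq _ _) _; rewrite size_polyXn.
rewrite (nterms_sum sz) (nterms_sum le_pK) !big_mkord.
rewrite (bigD1 (Ordinal lt_kK)) //= [in RHS](bigD1 (Ordinal lt_kK)) //=.
rewrite coefD coefZ coefXn eqxx pk0 mulr1 add0r nz_c eqxx /=.
apply: (congr1 S); apply: eq_bigr => i; rewrite -val_eqE /= => /negPf ni.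
by rewrite coefD coefZ coefXn ni mulr0 addr0.
Qed.

Lemma nterms_mulX p : nterms (p * 'X) = nterms p.
Proof.
rewrite (@nterms_sum (p * 'X) (size p).+1); last first.
  by apply: leq_trans (size_polyMleq _ _) _; rewrite size_polyX addn2.
rewrite (nterms_sum (leqnn _)) big_nat_recl // coefMX /= !eqxx add0n.
by apply: eq_bigr => i _; rewrite coefMX.
Qed.
End Terms.

Lemma nterms_deriv (R : numDomainType) (p : {poly R}) : p`_0 != 0 ->
  nterms p = (nterms p^`()).+1.
Proof.
move=> nz_p0; rewrite (@nterms_sum _ p (size p).+1) // (@nterms_sum _ _ (size p)); last first.
  by apply/ltnW/lt_size_deriv; apply: contraNneq nz_p0 => ->; rewrite coef0.
rewrite big_nat_recl //= nz_p0 add1n; congr _.+1; apply: eq_bigr => i _.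
by rewrite coef_deriv mulrn_eq0.
Qed.

(** * Rolle's theorem and Descartes' bound on negative roots *)

Section RealPoly.
Variable R : rcfType.
Implicit Type p : {poly R}.

(** Rolle's theorem on each gap between consecutive roots. The bound by the last root is what keeps
    the new roots negative in the next lemma. *)
Lemma rolle_path p (x : R) s : path <%R x s -> all (> x) s ->
   all (root p) (x :: s) ->
  exists t, [/\ path <%R x t, size t = size s, all (root p^`()) t &
    all (< last x s) t].
Proof.
elim: s x => [|y s IHs] x /=; first by exists [::].
move=> /andP[lt_xy y_s] _ /and3P[px0 py0 s0].
have gt_s: all (> y) s by rewrite order_path_min //; apply: lt_trans.
have [|t [y_t sz_t t0 lt_t]] := IHs y y_s gt_s; first by rewrite /= py0.
have [c] := poly_rolle lt_xy (etrans (eqP px0) (esym (eqP py0))).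
rewrite in_itv /= => /andP[lt_xc lt_cy] /eqP p'c0.
exists (c :: t); split=> /=; rewrite ?lt_xc ?sz_t ?t0 ?andbT //.
- by case: (t) y_t => //= z u /andP[lt_yz ->]; rewrite (lt_trans lt_cy).
- rewrite lt_t andbT (lt_le_trans lt_cy) //.
  by have := mem_last y s; rewrite inE => /predU1P[->|/(allP gt_s)/ltW].
Qed.

(** Descartes' rule by induction on the size. A factor ['X] changes neither the terms nor the
    negative roots; if the constant coefficient is nonzero, differentiation loses exactly one term
    and, by Rolle, at most one root of the list. *)
Lemma nterms_neg_roots p (s : seq R) : p != 0 -> uniq s -> all (< 0) s -> all (root p) s ->
  (size s < nterms p)%N.
Proof.
have [n] := ubnP (size p); elim: n p s => // n IHn p s /ltnSE le_pn nz_p.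
have [p0|nz_p0] := eqVneq p`_0 0.
  have [q Dp]: exists q, p = q * 'X.
    have /factor_theorem[q ->]: root p 0 by rewrite /root horner_coef0 p0.
    by exists q; rewrite subr0.
  have nz_q: q != 0 by apply: contraNneq nz_p => q0; rewrite Dp q0 mul0r.
  move=> Us neg_s s0; rewrite Dp nterms_mulX; apply: IHn => //.
    by rewrite -ltnS -(size_mulX nz_q) -Dp.
  apply/allP=> x s_x; have := allP s0 x s_x; rewrite Dp rootM rootX.
  rewrite orbC lt_eqF //; apply: (allP neg_s x s_x).
move=> Us neg_s s0; rewrite nterms_deriv // ltnS.
have [t [Ut Dt]]: exists t, sorted <%R t /\ perm_eq s t.
  by exists (sort <=%R s); rewrite sort_lt_sorted Us perm_sym perm_sort.
move: neg_s s0; rewrite (perm_size Dt) !(perm_all _ Dt).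
case: t Ut {Dt s Us} => // x s x_s neg_s s0.
have [|t [x_t sz_t t0 lt_t]] := rolle_path x_s _ s0.
  by rewrite order_path_min //; apply: lt_trans.
rewrite /= -sz_t; apply: IHn => //.
- by apply: leq_trans le_pn; rewrite lt_size_deriv.
(* If the derivative vanished, [p] would be a constant with a root, contradicting [nz_p0]. *)
- apply: contraNneq nz_p0 => p'0; have Dp: p = (p`_0)%:P.
    apply/polyP=> -[|i]; rewrite coefC //=; apply/eqP.
    have /eqP := congr1 (fun q : {poly R} => q`_i) p'0.
    by rewrite coef0 coef_deriv mulrn_eq0.
  have /andP[/rootP px0 _] := s0.
  have: p.[x] = p`_0 by rewrite [in LHS]Dp hornerC.
  by rewrite px0 => <-.
- exact: lt_sorted_uniq (path_sorted x_t).
- apply/allP=> y t_y; apply: lt_trans (allP lt_t y t_y) _.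
  exact: (allP neg_s _ (mem_last x s)).
Qed.
End RealPoly.

(** * Alternating coefficients *)

Section Alternation.
Variable R : realDomainType.
Implicit Types (u w : nat -> R) (s Z : seq nat).

(** The length of such a list is at most one more than the number of sign changes of [u]. *)
Definition alternating u s :=
  all (fun i => u i != 0) s && sorted (fun i j => (i < j)%N && (u i * u j < 0)) s.

Lemma alternating_drop u s z : alternating u s -> exists s',
  [/\ alternating u s', z \notin s', {subset s' <= s} & (size s <= (size s').+2)%N].
Proof.
have [s_z|] := boolP (z \in s); last by exists s; split => //; apply/ltnW/ltnW.
case/andP=> nz_s alt_s.
have Us: uniq s.
  apply: (@sorted_uniq _ ltn ltn_trans ltnn).
  by apply: sub_sorted alt_s => i j /andP[].
case/splitPr: s / s_z nz_s alt_s Us => s1 s2 nz_s alt_s Us.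
(* dropping [z] together with its successor keeps the signs alternating *)
exists (s1 ++ behead s2).
have s's: {subset s1 ++ behead s2 <= s1 ++ z :: s2}.
  by move=> i; rewrite !mem_cat inE => /orP[->//|/mem_behead->]; rewrite !orbT.
split=> //; last 1 first.
- by rewrite !size_cat size_behead /=; lia.
- apply/andP; split.
    by apply/allP=> i /s's; apply: (allP nz_s).
  case: s1 s2 alt_s {nz_s s's Us} => [|x s1] [|y s2] /=; rewrite ?cats0 //.
  + by case/andP=> _ /path_sorted.
  + by rewrite cat_path => /andP[].
  rewrite !cat_path => /and4P[-> /=]; case: s2 => //= v s2.
  move=> /andP[lt_xz uxz] /andP[lt_zy uzy] /andP[/andP[lt_yv uyv] v_s2].
  apply/andP; split; last exact: v_s2.
  rewrite (ltn_trans lt_xz) ?(ltn_trans lt_zy) //=.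
  (* Multiplying by the negative number [u z * u y] reduces the claim to the product of two negative
     numbers being positive. *)
  rewrite -(nmulr_rgt0 _ uzy).
  have -> : u z * u y * (u (last x s1) * u v) = (u (last x s1) * u z) * (u y * u v).
    by ring.
  by rewrite (nmulr_rgt0 _ uxz).
- move: Us; rewrite cat_uniq /= => /and4P[_ /norP[n_z _] n_z2 _].
  by rewrite mem_cat negb_or n_z; apply: contra n_z2 => /mem_behead.
Qed.


(* The sign of [u i = w i + w (i - 1)] is already that of one of its two terms. *)
Lemma alternating_pull u w s : alternating u s ->
  {in s, forall i, u i = w i + (if i is j.+1 then w j else 0)} ->
  exists2 t, alternating w t & size t = size s.
Proof.
case/andP=> nz_s alt_s Du; pose phi i := if 0 < u i * w i then i else i.-1.
have uphi i : i \in s -> 0 < u i * w (phi i).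
  move=> s_i; rewrite /phi; case: ifPn => // n_uw.
  have: 0 < u i * u i by rewrite -expr2 exprn_even_gt0 //= (allP nz_s).
  rewrite {2}Du // mulrDr; case: i {s_i} n_uw => [|i] /=; rewrite ?mulr0; lra.
exists (map phi s); last by rewrite size_map.
apply/andP; split.
  apply/allP=> _ /mapP[i s_i ->]; apply: contraTneq (uphi i s_i) => ->.
  by rewrite mulr0 ltxx.
rewrite sorted_map; apply: (sub_in_sorted (P := mem s)) alt_s; last exact/allP.
move=> i j s_i s_j /= /andP[lt_ij uij].
have [ui uj] := (uphi i s_i, uphi j s_j).
have wij: w (phi i) * w (phi j) < 0.
  by rewrite -(nmulr_rgt0 _ uij) mulrACA mulr_gt0.
(* [phi] lowers an index by at most one, so [i < j] gives [phi i <= phi j]; equality would make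
   [wij] a negative square. *)
rewrite wij andbT ltn_neqAle; apply/andP; split.
  by apply: contraTneq wij => ->; rewrite -leNgt -expr2 sqr_ge0.
by rewrite /phi; case: ifP => _; case: ifP => _; lia.
Qed.
End Alternation.

(** * Sign alternation passed from column to column *)

Section Columns.
Variable R : realDomainType.
Implicit Types (u : nat -> R) (s Z : seq nat) (p : {poly R}) (F q : {poly {poly R}}).

Lemma alternating_avoid u s Z : alternating u s -> exists t,
  [/\ alternating u t, {in t, forall i, i \notin Z} & (size s <= size t + 2 * size Z)%N].
Proof.
elim: Z => [|z Z IHZ] alt_s; first by exists s; rewrite addn0.
have [t [alt_t tZ le_st]] := IHZ alt_s.
have [t' [alt_t' t'z t't le_tt']] := alternating_drop z alt_t.
exists t'; split=> //=; last by lia.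
move=> i t'i; rewrite inE negb_or tZ ?t't // andbT.
by apply: contraNneq t'z => <-.
Qed.

Definition support p := [seq i <- iota 0 (size p) | p`_i != 0].

Lemma mem_support p i : (i \in support p) = (p`_i != 0).
Proof.
rewrite mem_filter mem_iota add0n /= andb_idr // => nz_pi.
by apply: contraR nz_pi; rewrite -leqNgt => /(nth_default 0) ->.
Qed.

Lemma size_support p : size (support p) = nterms p.
Proof.
rewrite size_filter (nterms_sum (leqnn _)) -sum1_count big_mkcond /index_iota subn0.
by apply: eq_bigr => i _; case: eqP.
Qed.

Lemma alternating_leq_nterms p s : p != 0 ->
  alternating (fun i => (-1) ^+ i * p`_i) s -> (size s <= nterms p)%N.
Proof.
move=> nz_p /andP[nz_s alt_s]; rewrite -size_support uniq_leq_size //.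
  apply: (@sorted_uniq _ ltn ltn_trans ltnn).
  by apply: sub_sorted alt_s => i j /andP[].
by move=> i /(allP nz_s); rewrite mulf_eq0 signr_eq0 mem_support.
Qed.

(** Discarding the indices that lie in the support of F_(a+1) costs at most two entries for each of
    its terms; what is left is pulled back to q_(a+1). The process ends when q_(a+1) = 0: then q_a =
    F_(a+1), whose number of terms already bounds the list, so that the inequality with the factor 2
    is strict. *)
Lemma alternating_ltn_nterms F q M a s :
    (forall i, q`_i = F`_i.+1 + (1 - 'X) * q`_i.+1) -> (size q < M)%N ->
    q`_a != 0 -> alternating (fun i => (-1) ^+ i * q`_a`_i) s ->
  (size s < 2 * \sum_(a.+1 <= i < M) nterms F`_i)%N.
Proof.
move=> Dq lt_qM; have [k] := ubnP (size q - a); elim: k a s => // k IHk a s le_k nz_qa alt_s.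
have lt_aq : (a < size q)%N.
  by apply: contraR nz_qa; rewrite -leqNgt => /(nth_default 0) ->.
rewrite big_ltn; last by apply: leq_ltn_trans lt_qM.
have [q0|nz_q] := eqVneq q`_a.+1 0.
  have Dqa: q`_a = F`_a.+1 by rewrite Dq q0 mulr0 addr0.
  have := alternating_leq_nterms nz_qa alt_s; rewrite -nterms_gt0 in nz_qa.
  rewrite -Dqa; move: (nterms _) nz_qa => n; lia.
have [t [alt_t tF le_st]] := alternating_avoid (support F`_a.+1) alt_s.
have [|t' alt_t' sz_t'] := @alternating_pull _ _ (fun i => (-1) ^+ i * q`_a.+1`_i) _ alt_t.
  move=> i /tF; rewrite mem_support negbK => /eqP Fi0.
  (* The twist by (-1)^i turns multiplication by 1 - y into the sum of two neighbouring terms. *)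
  rewrite Dq coefD Fi0 add0r mulrBl mul1r coefB coefXM.
  by case: i {Fi0} => [|i] /=; rewrite ?subr0 ?addr0 // exprS; ring.
have := IHk a.+1 t' _ nz_q alt_t'; rewrite size_support in le_st.
by move/(_ ltac:(lia)); lia.
Qed.

(** With q the quotient of F - 1 by x - (1 - y), the coefficients of q_0 below the degree of F_0 are
    positive, so that all these indices form an alternating list for (-1)^i q_(0,i). *)
Lemma size_head_column_leq F M : (size F <= M)%N -> F.[1 - 'X] = 1 ->
    (forall i, 0 <= (F`_0)`_i) -> (1 < size (F`_0)%R)%N ->
  (size (F`_0)%R <= 2 * \sum_(1 <= i < M) nterms F`_i)%N.
Proof.
move=> le_FM F1 F0ge0 gt1_F0.
have /factor_theorem[q Dq]: root (F - 1) (1 - 'X).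
  by rewrite rootE hornerD hornerN F1 hornerC subrr.
have Dq0: F`_0 = 1 - q`_0 * (1 - 'X).
  have := congr1 (fun p : {poly {poly R}} => p`_0) Dq.
  rewrite /= coefB coef1 mulrBr coefB coefMX coefMC sub0r eqxx => /eqP.
  by rewrite subr_eq addrC => /eqP.
have Dqi i: q`_i = F`_i.+1 + (1 - 'X) * q`_i.+1.
  have := congr1 (fun p : {poly {poly R}} => p`_i.+1) Dq.
  rewrite /= coefB coef1 subr0 mulrBr coefB coefMX coefMC /= => ->.
  by rewrite [q`_i.+1 * _]mulrC subrK.
have DF0 i : (F`_0)`_i = (i == 0%N)%:R - ((q`_0)`_i - (if i is j.+1 then (q`_0)`_j else 0)).
  by rewrite Dq0 mulrBr mulr1 !coefB coef1 coefMX; case: i.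
have Dq0i i: (q`_0)`_i = 1 - \sum_(0 <= k < i.+1) (F`_0)`_k.
  elim: i => [|i IHi]; first by rewrite big_nat1 DF0 /=; ring.
  by rewrite big_nat_recr // opprD addrA -IHi DF0 /=; ring.
have F01: \sum_(0 <= k < size (F`_0)%R) (F`_0)`_k = 1.
  have := congr1 (fun p : {poly R} => p.[1]) Dq0.
  rewrite hornerD hornerN hornerM !hornerE subrr mulr0 subr0 => <-.
  rewrite horner_coef big_mkord; apply: eq_bigr => i _.
  by rewrite expr1n mulr1.
(* As the coefficients of F_0 sum to 1, this coefficient is the sum of those of index above [i],
   among them the positive leading one. *)
have q0gt0 i: (i.+1 < size (F`_0)%R)%N -> 0 < (q`_0)`_i.
  move=> lt_i; rewrite Dq0i -F01 (big_cat_nat (n := i.+1)) ?(ltnW lt_i) //= addrAC subrr add0r.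
  rewrite -(prednK (ltn_trans (ltn0Sn _) lt_i)) big_nat_recr ?ltn_predRL //=.
  rewrite ltr_wpDl ?sumr_ge0 // lt_neqAle F0ge0 andbT eq_sym.
  by rewrite -lead_coefE lead_coef_eq0 -size_poly_gt0 (ltn_trans _ lt_i).
have nz_q0 : q`_0 != 0.
  by apply: contraTneq (q0gt0 0%N gt1_F0) => ->; rewrite coef0 ltxx.
have lt_qM: (size q < M)%N.
  have nz_q: q != 0 by apply: contraNneq nz_q0 => ->; rewrite coef0.
  apply: leq_trans le_FM; have := size_polyD F (- 1).
  rewrite Dq size_Mmonic ?monicXsubC // size_XsubC addn2 /= size_polyN size_poly1.
  move/leq_trans; apply; rewrite geq_max leqnn size_poly_gt0.
  by apply: contraTneq gt1_F0 => ->; rewrite coef0 size_poly0.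
have := @alternating_ltn_nterms F q M 0 (iota 0 (size (F`_0)).-1) Dqi lt_qM nz_q0.
rewrite size_iota prednK ?(ltnW gt1_F0) //; apply.
apply/andP; split.
  apply/allP=> i; rewrite mem_iota => /andP[_ lt_i].
  by rewrite mulf_neq0 ?signr_eq0 // gt_eqF // q0gt0 // -ltn_predRL.
apply/(sortedP 0%N) => i; rewrite size_iota => lt_i.
rewrite !nth_iota ?(ltnW lt_i) // !add0n leqnn /= exprS.
rewrite ltn_predRL in lt_i.
have q_gt0 := mulr_gt0 (q0gt0 i (ltnW lt_i)) (q0gt0 i.+1 lt_i).
by rewrite mulN1r mulNr mulrN mulrACA -expr2 sqrr_sign mul1r oppr_lt0.
Qed.
End Columns.

(** * The lower bound *)

Section UnityRoots.
Variables (R : rcfType) (r : nat) (eta : complex R).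
Hypothesis eta_prim : (r.*2.+1).-primitive_root eta.

(** If v^2 = eta^(j+1), this is v^2 + v^-2 - 2 = (v^-1 - v)^2. *)
Let theta (j : nat) : R := complex.Re (eta ^+ j.+1) *+ 2 - 2.

Let unity_root_conj j : (eta ^+ j)^-1 = conjc (eta ^+ j).
Proof.
have n1: `|eta ^+ j| = 1.
  apply/eqP; rewrite -(@pexpr_eq1 _ _ r.*2.+1) // -normrX exprAC.
  by rewrite (prim_expr_order eta_prim) expr1n normr1.
by rewrite invc_norm n1 expr1n invr1 mul1r.
Qed.

Let thetaE j : real_complex R (theta j) = eta ^+ j.+1 + (eta ^+ j.+1)^-1 - 2.
Proof.
by rewrite unity_root_conj addcJ /theta rmorphB rmorphMn rmorph_nat /= -mulr_natl.
Qed.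

Lemma unity_root_differences : exists s : seq R,
  [/\ uniq s, size s = r, all (< 0) s &
      {in s, forall z, exists v, [/\ v ^+ r.*2.+1 = 1, v != 0 &
        (v^-1 - v) ^+ 2 = real_complex R z]}].
Proof.
have eta_neq0 : eta != 0 by rewrite (prim_root_eq0 eta_prim).
have expr_inj i j : (i < r.*2.+1)%N -> (j < r.*2.+1)%N -> eta ^+ i = eta ^+ j -> i = j.
  move=> lti ltj /eqP; rewrite (eq_prim_root_expr eta_prim).
  by rewrite !modn_small // => /eqP.
exists (mkseq theta r); split.
- rewrite map_inj_in_uniq ?iota_uniq // => i j; rewrite !mem_iota !add0n /= => lti ltj.
  move/(congr1 (real_complex R)); rewrite !thetaE => /(addIr _).
  set x := eta ^+ i.+1; set y := eta ^+ j.+1 => Dxy.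
  have [nz_x nz_y]: x != 0 /\ y != 0 by rewrite !expf_neq0.
  (* x + 1/x = y + 1/y forces x = y or x y = 1; the latter is impossible because 0 < i + j + 2 < 2r
     + 1. *)
  have /eqP: (x - y) * (x * y - 1) = 0.
    have : (x + x^-1 - (y + y^-1)) * (x * y) = 0 by rewrite Dxy subrr mul0r.
    move=> <-; by field; rewrite nz_x nz_y.
  rewrite mulf_eq0 !subr_eq0 => /orP[/eqP/expr_inj|].
    by move=> /(_ ltac:(lia) ltac:(lia)) [].
  rewrite -exprD => /eqP/(expr_inj _ 0%N); lia.
- by rewrite size_mkseq.
- apply/allP=> z /mapP[j]; rewrite mem_iota add0n => /andP[_ lt_jr] ->.
  have : eta ^+ j.+1 != 1.
    by rewrite -(prim_order_dvd eta_prim); apply/negP => /dvdn_leq; lia.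
  have := congr1 (fun x => eta ^+ j.+1 * x) (unity_root_conj j.+1).
  rewrite /= mulfV ?expf_neq0 // /theta; case: (eta ^+ j.+1) => a b /=.
  rewrite eq_complex /= => /esym/eqP; rewrite eq_complex /= => /andP[/eqP Dab _] ne1.
  have sqb : 0 <= b ^+ 2 by exact: sqr_ge0.
  have le1 : a <= 1 by nra.
  have ne : a != 1.
    apply: contraNneq ne1 => a1; rewrite a1 in Dab *.
    by rewrite eqxx -sqrf_eq0; apply/eqP; lra.
  have: a < 1 by rewrite lt_neqAle ne.
  by lra.
(* Since r + 1 is the inverse of 2 modulo 2r + 1, this is a square root of eta^(j+1). *)
move=> z /mapP[j _ ->]; exists (eta ^+ (j.+1 * r.+1)); split.
- by rewrite exprAC (prim_expr_order eta_prim) expr1n.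
- by rewrite expf_neq0.
have Dv2 : eta ^+ j.+1 = eta ^+ (j.+1 * r.+1) ^+ 2.
  rewrite -exprM; apply/eqP; rewrite (eq_prim_root_expr eta_prim).
  by rewrite (_ : (_ * _ * 2 = j.+1 * r.*2.+1 + j.+1)%N) ?modnMDl //; lia.
rewrite thetaE Dv2; move: (eta ^+ (_ * _)) (expf_neq0 (j.+1 * r.+1) eta_neq0) => v nz_v.
by field.
Qed.
End UnityRoots.

Lemma big_nat_double (V : nmodType) (f : nat -> V) K :
  \sum_(0 <= a < K.*2) f a = \sum_(0 <= k < K) f k.*2 + \sum_(0 <= k < K) f k.*2.+1.
Proof.
elim: K => [|K IHK]; first by rewrite !big_geq // addr0.
by rewrite doubleS !big_nat_recr //= IHK -!addrA; congr (_ + _); rewrite addrCA.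
Qed.

Lemma horner_pos (R : numDomainType) (p : {poly R}) x :
  (forall i, 0 <= p`_i) -> 0 < x -> p != 0 -> 0 < p.[x].
Proof.
move=> p_ge0 x_gt0 nz_p; rewrite horner_coef -(prednK (n := size p)) ?size_poly_gt0 //.
rewrite big_ord_recr /= ltr_wpDl ?sumr_ge0 // => [i _|].
  by rewrite mulr_ge0 // exprn_ge0 // ltW.
rewrite mulr_gt0 ?exprn_gt0 // lt_neqAle p_ge0 andbT eq_sym.
by rewrite -lead_coefE lead_coef_eq0.
Qed.

Lemma horner_ge0 (R : numDomainType) (p : {poly R}) x :
  (forall i, 0 <= p`_i) -> 0 <= x -> 0 <= p.[x].
Proof.
by move=> p_ge0 x_ge0; rewrite horner_coef sumr_ge0 // => i _; rewrite mulr_ge0 ?exprn_ge0.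
Qed.

Lemma horner_ge_term (R : numDomainType) (p : {poly R}) x b :
  (forall i, 0 <= p`_i) -> 0 <= x -> p`_b * x ^+ b <= p.[x].
Proof.
move=> p_ge0 x_ge0; have lt_b : (b < maxn (size p) b.+1)%N by rewrite leq_maxr.
rewrite (horner_coef_wide _ (leq_maxl _ b.+1)) (bigD1 (Ordinal lt_b)) //= lerDl.
by rewrite sumr_ge0 // => i _; rewrite mulr_ge0 ?exprn_ge0.
Qed.

Lemma nterms_monomial_leq1 (R : realDomainType) (p : {poly R}) n :
  (forall b, p`_b != 0 -> b = n) -> (nterms p <= 1)%N.
Proof.
move=> pn; rewrite -size_support -[1%N]/(size [:: n]) uniq_leq_size //.
  by rewrite filter_uniq // iota_uniq.
by move=> b; rewrite mem_support inE => /pn/eqP.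
Qed.

(** The right side has degree a + b > d in y. For y = 2 + e with e = 2^a / c, the bound y - 1 >= y /
    2 makes it at least y^(a+b) / e, and y^(a+b) >= y^(d+1) >= e y^d. *)
Lemma monomial_dominates (R : realFieldType) (c : R) a b d :
  0 < c -> (d < a + b)%N -> exists2 y, 1 <= y & y ^+ d <= c * y ^+ b * (y - 1) ^+ a.
Proof.
move=> c_gt0 lt_d; pose e : R := 2 ^+ a / c; exists (2 + e).
  by rewrite -[X in X <= _]addr0 lerD ?ler1n // divr_ge0 ?exprn_ge0 // ltW.
have e_ge0 : 0 <= e by rewrite divr_ge0 ?exprn_ge0 // ltW.
set y := 2 + e; have y_gt0 : 0 < y by rewrite /y; lra.
have le1 : (y / 2) ^+ a <= (y - 1) ^+ a.
  by rewrite lerXn2r ?nnegrE ?divr_ge0 //; rewrite /y; lra.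
apply: le_trans (ler_wpM2l _ le1); last by rewrite mulr_ge0 ?exprn_ge0 // ltW.
have e_gt0 : 0 < e by rewrite divr_gt0 ?exprn_gt0.
have -> : c * y ^+ b * (y / 2) ^+ a = y ^+ (a + b) / e.
  rewrite expr_div_n /e exprD; field.
  by rewrite gt_eqF //= expf_neq0 // pnatr_eq0.
rewrite ler_pdivlMr // mulrC; apply: (@le_trans _ _ (y ^+ d.+1)).
  by rewrite exprS ler_wpM2r ?exprn_ge0 ?ltW // /y; lra.
by apply: ler_weXn2l => //; rewrite /y; lra.
Qed.

(** * Counting the terms of an invariant polynomial *)

Section LowerBound.
Variables (R : rcfType) (r : nat) (eta : complex R) (F : {poly {poly R}}) (K : nat).
Hypothesis r_gt0 : (0 < r)%N.
Hypothesis eta_prim : (r.*2.+1).-primitive_root eta.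
Hypothesis F_line : F.[1 - 'X] = 1.
Hypothesis F_ge0 : forall a b, 0 <= (F`_a)`_b.
Hypothesis F_inv : forall a b, (F`_a)`_b != 0 -> (r.*2.+1 %| a + b.*2)%N.
Hypothesis F_00 : (F`_0)`_0 = 0.
Hypothesis le_FK : (size F <= K.*2)%N.

Let d := r.*2.+1.
Let g : {poly R} := \poly_(a < K.*2) (F`_a).[1].

Let g_coef a : g`_a = (F`_a).[1].
Proof.
rewrite coef_poly; case: ltnP => // le_Ka.
by rewrite (nth_default 0 (leq_trans le_FK le_Ka)) horner0.
Qed.

(** Non-negativity excludes cancellation in F_a(1), so the terms of [g] correspond to the nonzero
    columns. *)
Let g_coef_eq0 a : (g`_a == 0) = (F`_a == 0).
Proof.
apply/idP/eqP => [|Fa0]; last by rewrite g_coef Fa0 horner0.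
by apply: contraTeq => nzFa; rewrite g_coef gt_eqF // (horner_pos (F_ge0 a)).
Qed.

Let line y : \sum_(0 <= a < K.*2) (F`_a).[y] * (1 - y) ^+ a = 1.
Proof.
have := congr1 (fun p : {poly R} => p.[y]) F_line.
rewrite (horner_coef_wide _ le_FK) horner_sum hornerC => E; rewrite -[RHS]E.
rewrite big_mkord; apply: eq_bigr => a _.
by rewrite hornerM horner_exp !hornerE.
Qed.

Let line_complex (y : complex R) :
  \sum_(0 <= a < K.*2) (map_poly (real_complex R) F`_a).[y] * (1 - y) ^+ a = 1.
Proof.
have := congr1 (fun p : {poly R} => (map_poly (real_complex R) p).[y]) F_line.
rewrite (horner_coef_wide _ le_FK) rmorph_sum horner_sum /= rmorph1 hornerC => E; rewrite -[RHS]E.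
rewrite big_mkord; apply: eq_bigr => a _.
by rewrite rmorphM rmorphXn rmorphB rmorph1 /= map_polyX hornerM horner_exp !hornerE.
Qed.

(** At y = v^2 and x = 1 - v^2 = v (v^-1 - v), the monomial x^a y^b equals v^(a+2b) (v^-1 - v)^a,
    and v^(a+2b) = 1 by invariance. *)
Let g_root v : v ^+ d = 1 -> v != 0 -> (map_poly (real_complex R) g).[v^-1 - v] = 1.
Proof.
move=> vd1 nz_v; rewrite -(line_complex (v ^+ 2)) (@horner_coef_wide _ K.*2); last first.
  by rewrite size_map_poly size_poly.
rewrite big_mkord; apply: eq_bigr => a _; rewrite coef_map g_coef /=.
rewrite (_ : 1 - v ^+ 2 = v * (v^-1 - v)) ?exprMn ?mulrA; last by field.
congr (_ * _); rewrite !horner_coef size_map_poly rmorph_sum /= mulr_suml.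
apply: eq_bigr => b _; rewrite coef_map expr1n mulr1 -mulrA -exprM -exprD /=.
have [->|/F_inv/dvdnP[c Dc]] := eqVneq (F`_a)`_b 0; first by rewrite rmorph0 mul0r.
by rewrite mul2n addnC Dc mulnC exprM vd1 expr1n mulr1.
Qed.

Let K_gt0 : (0 < K)%N.
Proof.
rewrite lt0n; apply: contraTneq le_FK => ->; rewrite leqn0 size_poly_eq0.
by apply: contra_eq_neq F_line => ->; rewrite horner0 eq_sym oner_neq0.
Qed.

Let F0_horner1 : (F`_0).[1] = 1.
Proof.
have := line 1; rewrite -(prednK K_gt0).
rewrite doubleS big_nat_recl //= subrr big1 ?addr0 ?expr0 ?mulr1 // => a _.
by rewrite exprS mul0r mulr0.
Qed.

Let even_part := even_poly (g - 1).
Let odd_part := odd_poly (g - 1).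

(** Exchanging v and v^-1 changes the sign of x = v^-1 - v, so g - 1 vanishes at both x and -x.
    Hence its even and odd parts both vanish at x^2, as x is nonzero. *)
Let parts_neg_roots : exists s : seq R, [/\ uniq s, size s = r, all (< 0) s,
  all (root even_part) s & all (root odd_part) s].
Proof.
have [s [Us sz_s neg_s s_v]] := unity_root_differences eta_prim.
have s0 : {in s, forall z, root even_part z /\ root odd_part z}.
  move=> z s_z; have [v [vd1 nz_v v2]] := s_v z s_z.
  pose P := map_poly (real_complex R) (g - 1).
  have P0 w : w ^+ d = 1 -> w != 0 -> P.[w^-1 - w] = 0.
    by move=> wd1 nz_w; rewrite /P rmorphB rmorph1 hornerD hornerN hornerC g_root ?subrr.
  have Px x : x ^+ 2 = real_complex R z ->
      P.[x] = real_complex R even_part.[z] + real_complex R odd_part.[z] * x.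
    move=> Dx; rewrite /P -(poly_even_odd (g - 1)) rmorphD rmorphM /= !map_comp_poly.
    by rewrite map_polyX map_polyXn hornerD hornerM !horner_comp hornerXn hornerX Dx !horner_map.
  have P1 := P0 v vd1 nz_v.
  have P2 : P.[- (v^-1 - v)] = 0.
    by rewrite opprB -{1}[v]invrK P0 ?invr_eq0 // exprVn vd1 invr1.
  rewrite Px // in P1; rewrite Px ?sqrrN // in P2.
  have e0 : real_complex R even_part.[z] = 0.
    move/eqP: (congr2 +%R P1 P2); rewrite mulrN addrACA subrr !addr0 -mulr2n.
    by rewrite mulrn_eq0 => /eqP.
  have nz_x : v^-1 - v != 0.
    rewrite -sqrf_eq0 v2 fmorph_eq0 lt_eqF //; exact: (allP neg_s).
  rewrite e0 add0r in P1; move/eqP: P1; rewrite mulf_eq0 (negPf nz_x) orbF.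
  by move/eqP: e0; rewrite !fmorph_eq0.
by exists s; split=> //; apply/allP=> z /s0[].
Qed.

Let sum_split : (\sum_(0 <= a < K.*2) nterms F`_a = nterms F`_0 +
  \sum_(1 <= k < K) nterms F`_k.*2 + \sum_(0 <= k < K) nterms F`_k.*2.+1)%N.
Proof. by rewrite (big_nat_double (V := nat)) [in LHS]big_ltn. Qed.

Let F_oob a : (K.*2 <= a)%N -> F`_a = 0.
Proof. by move=> le_Ka; rewrite nth_default // (leq_trans le_FK). Qed.

Let odd_partE k : (odd_part`_k == 0) = (F`_k.*2.+1 == 0).
Proof. by rewrite coef_odd_poly coefB coef1 subr0 g_coef_eq0. Qed.

Let even_part0 : even_part`_0 = 0.
Proof. by rewrite coef_even_poly coefB coef1 g_coef F0_horner1 subrr. Qed.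

Let even_partE k : (even_part`_k.+1 == 0) = (F`_k.+1.*2 == 0).
Proof. by rewrite coef_even_poly coefB coef1 subr0 g_coef_eq0. Qed.

(** The odd part has more than r terms by Descartes' rule, and each of them comes from a nonzero
    column, which contains at least one term. *)
Let odd_columns : odd_part != 0 -> (r < \sum_(0 <= k < K) nterms F`_k.*2.+1)%N.
Proof.
move=> nz_o; have [s [Us sz_s neg_s _ s_o]] := parts_neg_roots.
rewrite -sz_s; apply: leq_trans (nterms_neg_roots nz_o Us neg_s s_o) _.
rewrite (@nterms_sum _ _ K); last first.
  apply/leq_sizeP => k le_Kk; apply/eqP; rewrite odd_partE F_oob //; lia.
apply: leq_sum => k _; rewrite odd_partE -nterms_gt0; case: (nterms _) => //.
Qed.

Let even_columns : even_part != 0 -> (r < \sum_(1 <= k < K) nterms F`_k.*2)%N.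
Proof.
move=> nz_e; have [s [Us sz_s neg_s s_e _]] := parts_neg_roots.
rewrite -sz_s; apply: leq_trans (nterms_neg_roots nz_e Us neg_s s_e) _.
rewrite (@nterms_sum _ _ K); last first.
  apply/leq_sizeP => -[|k] le_Kk; first by rewrite even_part0.
  by apply/eqP; rewrite even_partE F_oob //; lia.
(* F_0(1) = 1 cancels the constant term, so column 0 is not counted here. *)
rewrite big_ltn // even_part0 eqxx add0n !big_add1; apply: leq_sum => k _.
by rewrite even_partE -nterms_gt0; case: (nterms _).
Qed.

(** Invariance gives d | 2b, and d is odd. *)
Let F0_coef b : (F`_0)`_b != 0 -> exists2 c, (0 < c)%N & b = (c * d)%N.
Proof.
move=> nzb; have /F_inv := nzb; rewrite add0n -(muln2 b) Gauss_dvdl; last first.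
  by rewrite coprimen2 /= odd_double.
case/dvdnP=> c Db; exists c => //; rewrite lt0n; apply: contraNneq nzb => c0.
by rewrite Db c0 F_00.
Qed.

Let F0_neq0 : F`_0 != 0.
Proof. by apply: contra_eq_neq F0_horner1 => ->; rewrite horner0 eq_sym oner_neq0. Qed.

Let F0_lead : exists2 c, (0 < c)%N & size F`_0 = (c * d).+1.
Proof.
have [|c c_gt0 Dc] := @F0_coef (size F`_0).-1.
  by rewrite -lead_coefE lead_coef_eq0.
by exists c; rewrite // -Dc prednK // size_poly_gt0.
Qed.

Let line_split y : (F`_0).[y] + \sum_(1 <= k < K) (F`_k.*2).[y] * (1 - y) ^+ k.*2
  + \sum_(0 <= k < K) (F`_k.*2.+1).[y] * (1 - y) ^+ k.*2.+1 = 1.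
Proof. by rewrite -[RHS](line y) big_nat_double [X in _ = X + _]big_ltn // expr0 mulr1. Qed.

Lemma nterms_special : let N := (\sum_(0 <= a < K.*2) nterms F`_a)%N in
  N = (r + 2)%N \/ (r.*2 + 3 <= N)%N.
Proof.
rewrite /=; have [c c_gt0 sz_F0] := F0_lead.
have nt_F0 : (0 < nterms F`_0)%N by rewrite nterms_gt0.
(* If deg F_0 >= 2d, the other columns have at least d + 1 = 2r + 2 terms, and F_0 adds one more. *)
have [c_gt1|c_le1] := ltnP 1 c.
  right; rewrite big_ltn ?double_gt0 //.
  have := size_head_column_leq le_FK F_line (F_ge0 0).
  have : (2 * d <= c * d)%N by rewrite leq_mul2r c_gt1 orbT.
  rewrite sz_F0 /d; move: (\sum_(1 <= i < _) _)%N (c * _)%N => S D le_D /(_ ltac:(lia)) lt_DS.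
  by apply: leq_trans (leq_add nt_F0 (leqnn S)); lia.
have {c c_gt0 c_le1} sz_F0 : size F`_0 = d.+1 by rewrite sz_F0; congr _.+1; nia.
have F0E : F`_0 = 'X^d.
  have F0b b : b != d -> (F`_0)`_b = 0.
    move=> ne_bd; apply/eqP; apply: contraTT (leqnn d) => nzb.
    have [c c_gt0 Db] := F0_coef nzb.
    have : (b < size (F`_0)%R)%N by apply: contraR nzb; rewrite -leqNgt => /(nth_default 0)->.
    rewrite sz_F0 Db ltnS; case: c Db c_gt0 => [|[|c]] //; first by rewrite mul1n => bd; rewrite bd eqxx in ne_bd.
    by rewrite /d; lia.
  have F0d : F`_0 = (F`_0)`_d *: 'X^d.
    apply/polyP=> b; rewrite coefZ coefXn.
    by have [->|/F0b->] := eqVneq b d; rewrite ?mulr1 ?mulr0.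
  have := F0_horner1; rewrite F0d hornerZ hornerXn expr1n mulr1 => ->.
  by rewrite scale1r.
have nt1 : nterms F`_0 = 1%N.
  rewrite F0E -['X^d]scale1r -[_ *: _]add0r nterms_addXn ?oner_neq0 ?coef0 //.
  by rewrite /nterms polyseq0.
(* At the point (-1, 2) of the line the even columns contribute non-negatively, and F_0 alone gives
   2^d > 1. *)
have nz_o : odd_part != 0.
  apply/eqP=> o0; have := line_split 2.
  have Fodd k : F`_k.*2.+1 = 0 by apply/eqP; rewrite -odd_partE o0 coef0.
  rewrite [X in _ + X]big1 => [|k _]; last by rewrite Fodd horner0 mul0r.
  rewrite addr0 F0E hornerXn.
  have: 0 <= \sum_(1 <= k < K) (F`_k.*2).[2] * (1 - 2) ^+ k.*2.
    rewrite sumr_ge0 // => k _; rewrite mulr_ge0 ?horner_ge0 //.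
    by rewrite exprn_even_ge0 // odd_double.
  have: 1 < 2 ^+ d :> R by rewrite exprn_egt1 // ltr1n.
  lra.
have S1 := odd_columns nz_o.
have [e0|nz_e] := eqVneq even_part 0; last first.
  by right; rewrite sum_split nt1; have := even_columns nz_e; lia.
left; rewrite sum_split nt1.
have Feven k : F`_k.+1.*2 = 0 by apply/eqP; rewrite -even_partE e0 coef0.
rewrite big_add1 big1 => [|k _]; last by rewrite Feven /nterms polyseq0.
(* [S1] gives the opposite bound. The relation a + 2b = d will leave at most one term in each column
   a = 2k + 1 with k <= r, namely b = r - k. *)
suff: (\sum_(0 <= k < K) nterms F`_k.*2.+1 <= r.+1)%N by lia.
have deg a b : odd a -> (F`_a)`_b != 0 -> (a + b.*2)%N = d.
  move=> odd_a nzab; have Da : a = a./2.*2.+1 by rewrite -{1}(odd_double_half a) odd_a.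
  have le_abd : (a + b <= d)%N.
    rewrite leqNgt; apply/negP => lt_dab.
    have c_gt0 : 0 < (F`_a)`_b by rewrite lt_neqAle eq_sym nzab F_ge0.
    (* For y >= 1 every odd column contributes a non-positive amount on the line. A term of degree
       above d would at this y outweigh y^d, and the total could not be 1. *)
    have [y y_ge1 le_yd] := monomial_dominates c_gt0 lt_dab.
    have y_ge0 : 0 <= y by apply: le_trans y_ge1.
    have := line_split y; rewrite F0E hornerXn big_add1 big1 => [|k _]; last first.
      by rewrite Feven horner0 mul0r.
    have lt_aK : (a./2 < K)%N.
      rewrite ltnNge; apply: contra nzab => le_Ka.
      by rewrite F_oob ?coef0 // Da; lia.
    rewrite addr0 big_mkord (bigD1 (Ordinal lt_aK)) //= -Da.
    set S := \sum_(_ < _ | _) _; have S_le0 : S <= 0.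
      rewrite sumr_le0 // => k _; rewrite mulr_ge0_le0 ?horner_ge0 //.
      by rewrite exprn_odd_le0 ?subr_le0 //= odd_double.
    rewrite -[1 - y]opprB exprNn -signr_odd odd_a expr1 mulN1r mulrN.
    have := horner_ge_term b (F_ge0 a) y_ge0.
    move/(ler_wpM2r (exprn_ge0 a (_ : 0 <= y - 1))); rewrite subr_ge0 => /(_ y_ge1).
    lra.
  (* With a odd and a + b <= d one has 0 < a + 2b < 2d, so the multiple of d is d itself. *)
  have /dvdnP[m Dm] := F_inv nzab.
  move: Dm; rewrite -/d; case: m => [|[|m]]; rewrite ?mul1n // => Dm.
    by move: Dm; rewrite Da; lia.
  by exfalso; move: Dm le_abd; rewrite Da -!muln2 /d; nia.
have sum_lt m : (\sum_(0 <= k < K) (k < m) <= m)%N.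
  suff -> : (\sum_(0 <= k < K) (k < m) = minn K m)%N by rewrite geq_minr.
  elim: (K) => [|n IHn]; first by rewrite big_geq // min0n.
  by rewrite big_nat_recr //= IHn; case: (ltnP n m) => ?; lia.
apply: leq_trans (sum_lt _); apply: leq_sum => k _.
have [->|nzF] := eqVneq F`_k.*2.+1 0; first by rewrite /nterms polyseq0.
have nzlead : (F`_k.*2.+1)`_(size F`_k.*2.+1).-1 != 0.
  by rewrite -lead_coefE lead_coef_eq0.
have odd_k : odd k.*2.+1 by rewrite /= odd_double.
have := deg _ _ odd_k nzlead; rewrite /d => Dk.
rewrite (_ : (k < r.+1)%N); last by lia.
apply: (@nterms_monomial_leq1 _ _ (r - k)) => b /(deg _ _ odd_k).
by rewrite /d; lia.
Qed.
End LowerBound.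

(** * Polynomials in two variables *)

Definition mn2 (a b : nat) : 'X_{1..2} := [multinom pt2 a b i | i < 2].

Notation xexp m := ((m : 'X_{1..2}) ord0).
Notation yexp m := ((m : 'X_{1..2}) ord_max).

Lemma mn2_x a b : xexp (mn2 a b) = a. Proof. by rewrite mnmE. Qed.
Lemma mn2_y a b : yexp (mn2 a b) = b. Proof. by rewrite mnmE. Qed.

Lemma mn2P (m1 m2 : 'X_{1..2}) : xexp m1 = xexp m2 -> yexp m1 = yexp m2 -> m1 = m2.
Proof.
move=> eqx eqy; apply/mnmP => i; case: (unliftP ord0 i) => [j ->|-> //].
by rewrite (_ : lift ord0 j = ord_max) //; apply: val_inj; rewrite /= (ord1 j).
Qed.

Lemma mn2K m : mn2 (xexp m) (yexp m) = m.
Proof. by apply: mn2P; rewrite ?mn2_x ?mn2_y. Qed.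

Lemma mdeg2 (m : 'X_{1..2}) : mdeg m = (xexp m + yexp m)%N.
Proof.
rewrite mdegE big_ord_recl big_ord1; congr (_ + m _)%N; exact: val_inj.
Qed.

Section Grid.
Variable R : comNzRingType.
Implicit Type f : {mpoly R[2]}.

Lemma msupp_grid f M : (forall m, f@_m != 0 -> (mdeg m < M)%N) ->
  perm_eq (msupp f) [seq m <- [seq mn2 a b | a <- iota 0 M, b <- iota 0 M] | f@_m != 0].
Proof.
move=> lt_M; apply: uniq_perm; rewrite ?msupp_uniq ?filter_uniq //.
  apply: allpairs_uniq; rewrite ?iota_uniq // => -[a b] [a' b'] _ _ /= E.
  by rewrite -(mn2_x a b) -[in X in (_, X)](mn2_y a b) E mn2_x mn2_y.
move=> m; rewrite mem_filter mcoeff_msupp andb_idr // => /lt_M; rewrite mdeg2 => lt_mM.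
by rewrite -(mn2K m); apply: allpairs_f; rewrite mem_iota; lia.
Qed.

Lemma meval_grid f M x y : (forall m, f@_m != 0 -> (mdeg m < M)%N) ->
  f.@[pt2 x y] = \sum_(0 <= a < M) \sum_(0 <= b < M) f@_(mn2 a b) * (x ^+ a * y ^+ b).
Proof.
move=> lt_M; rewrite mevalE (perm_big _ (msupp_grid lt_M)) big_filter big_mkcond /=.
rewrite big_allpairs_dep /index_iota subn0; apply: eq_bigr => a _; apply: eq_bigr => b _.
rewrite big_ord_recl big_ord1 /= !mnmE; have [->|//] := eqVneq; by rewrite mul0r.
Qed.

Lemma size_msupp_grid f M : (forall m, f@_m != 0 -> (mdeg m < M)%N) ->
  size (msupp f) = (\sum_(0 <= a < M) \sum_(0 <= b < M) (f@_(mn2 a b) != 0)%R)%N.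
Proof.
move=> lt_M; rewrite (perm_size (msupp_grid lt_M)) size_filter -sum1_count big_mkcond /=.
rewrite big_allpairs_dep /index_iota subn0; apply: eq_bigr => a _; apply: eq_bigr => b _.
by case: eqP.
Qed.

(** The coefficients F_a(y) in f = sum_a x^a F_a(y); [msize f] exceeds both exponents of every
    monomial of [f]. *)
Definition columns f : {poly {poly R}} :=
  \poly_(a < msize f) \poly_(b < msize f) f@_(mn2 a b).

Lemma columnsE f a b : ((columns f)`_a)`_b = f@_(mn2 a b).
Proof.
have oob : (msize f <= a + b)%N -> f@_(mn2 a b) = 0.
  by move=> le_f; apply/memN_msupp_eq0/msize_mdeg_ge; rewrite mdeg2 mn2_x mn2_y.
rewrite coef_poly; case: ltnP => [_|le_a]; last by rewrite coef0 oob // (leq_trans le_a) ?leq_addr.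
by rewrite coef_poly; case: ltnP => // le_b; rewrite oob // (leq_trans le_b) ?leq_addl.
Qed.

Lemma size_columns f : (size (columns f) <= msize f)%N.
Proof. exact: size_poly. Qed.

Lemma msize_bound f m : f@_m != 0 -> (mdeg m < msize f)%N.
Proof. by rewrite -mcoeff_msupp; apply: msize_mdeg_lt. Qed.

Lemma size_msupp_columns f M : (msize f <= M)%N ->
  size (msupp f) = (\sum_(0 <= a < M) nterms (columns f)`_a)%N.
Proof.
move=> le_fM; rewrite (size_msupp_grid (M := M)); last first.
  by move=> m /msize_bound lt_m; apply: leq_trans le_fM.
apply: eq_bigr => a _; rewrite (nterms_sum (K := M)).
  by apply: eq_bigr => b _; rewrite columnsE.
apply/leq_sizeP => b le_Mb; rewrite columnsE; apply/memN_msupp_eq0/msize_mdeg_ge.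
by rewrite mdeg2 mn2_x mn2_y; lia.
Qed.
End Grid.

(** * From identities of functions to conditions on monomials *)

Lemma poly_eq_horner (R : numDomainType) (p q : {poly R}) :
  (forall x, p.[x] = q.[x]) -> p = q.
Proof.
move=> pq; apply/eqP; rewrite -subr_eq0; apply: contraT => nz_pq.
have := max_poly_roots nz_pq (rs := mkseq (fun i => i%:R) (size (p - q))).
rewrite size_mkseq ltnn; apply.
  by apply/allP => x _; rewrite rootE hornerD hornerN pq subrr.
by rewrite mkseq_uniq // => i j /eqP; rewrite eqr_nat => /eqP.
Qed.

Lemma grid_eq0 (R : numDomainType) M (c : nat -> nat -> R) :
    (forall x y, \sum_(0 <= a < M) \sum_(0 <= b < M) c a b * (x ^+ a * y ^+ b) = 0) ->
  forall a b, (a < M)%N -> (b < M)%N -> c a b = 0.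
Proof.
move=> c0 a b lt_a lt_b.
have row x : \poly_(b < M) (\sum_(0 <= a < M) c a b * x ^+ a) = 0.
  apply: poly_eq_horner => y; rewrite horner_poly horner0 -[RHS](c0 x y).
  rewrite exchange_big big_mkord; apply: eq_bigr => i _; rewrite mulr_suml.
  by apply: eq_bigr => j _; rewrite mulrA.
have col : \poly_(a < M) c a b = 0.
  apply: poly_eq_horner => x; rewrite horner_poly horner0.
  have := congr1 (fun p : {poly R} => p`_b) (row x).
  by rewrite /= coef_poly lt_b coef0 big_mkord.
by have := congr1 (fun p : {poly R} => p`_a) col; rewrite /= coef_poly lt_a coef0.
Qed.

(* [special2] with invariance expressed on the monomials. *)
Definition wspecial (d : nat) (f : {mpoly RR[2]}) : Prop :=
  [/\ forall x y : RR, x + y = 1 -> f.@[pt2 x y] = 1,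
      forall m, 0 <= f@_m,
      forall m, f@_m != 0 -> (d %| xexp m + (yexp m).*2)%N & f@_0%MM = 0].

Lemma mn2_0 : mn2 0 0 = 0%MM.
Proof. by apply: mn2P; rewrite mnmE mnm0E. Qed.

Lemma meval00 (R : comNzRingType) (f : {mpoly R[2]}) : f.@[pt2 0 0] = f@_0%MM.
Proof.
rewrite (meval_grid (M := (msize f).+1)) => [|m /msize_bound/ltnW //].
rewrite big_nat_recl // big_nat_recl // mn2_0 !expr0 !mulr1.
rewrite [X in _ + X + _]big1 => [|b _]; last by rewrite exprS mul0r !mulr0.
rewrite [X in _ + X]big1 ?addr0 // => a _; rewrite big1 // => b _.
by rewrite exprS !mul0r mulr0.
Qed.

(** The action of [eta] multiplies x^a y^b by eta^(a+2b), and this factor is 1 exactly when d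
    divides a + 2b. *)
Lemma special2P d (eta : CC) f : d.-primitive_root eta -> special2 eta f <-> wspecial d f.
Proof.
move=> eta_prim; pose M := msize f.
have lt_M m : (polyC2 f)@_m != 0 -> (mdeg m < M)%N.
  by rewrite mcoeff_map_mpoly fmorph_eq0; apply: msize_bound.
have inv (x y : CC) : (polyC2 f).@[pt2 (eta * x) (eta ^+ 2 * y)] - (polyC2 f).@[pt2 x y] =
    \sum_(0 <= a < M) \sum_(0 <= b < M)
      (polyC2 f)@_(mn2 a b) * (eta ^+ (a + b.*2) - 1) * (x ^+ a * y ^+ b).
  rewrite !(meval_grid _ _ lt_M) -sumrB; apply: eq_bigr => a _.
  rewrite -sumrB; apply: eq_bigr => b _.
  rewrite (exprMn a) (exprMn b) -exprM exprD -muln2 [(2 * b)%N]mulnC; ring.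
split=> -[f1 f2 f3 f4]; split=> //; rewrite ?meval00 // -?meval00 //.
- move=> m nz_m; rewrite (prim_order_dvd eta_prim) -subr_eq0.
  have lt_m := msize_bound nz_m; rewrite mdeg2 in lt_m.
  have /eqP : (polyC2 f)@_(mn2 (xexp m) (yexp m)) * (eta ^+ (xexp m + (yexp m).*2) - 1) = 0.
    pose c a b := (polyC2 f)@_(mn2 a b) * (eta ^+ (a + b.*2) - 1).
    apply: (@grid_eq0 _ M c) => [x y||]; first by rewrite /c -inv f1 subrr.
    - exact: leq_ltn_trans (leq_addr _ _) lt_m.
    exact: leq_ltn_trans (leq_addl _ _) lt_m.
  by rewrite mn2K mulf_eq0 mcoeff_map_mpoly fmorph_eq0 (negPf nz_m).
- move=> x y; apply/eqP; rewrite -subr_eq0 inv big1 // => a _; rewrite big1 // => b _.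
  rewrite mcoeff_map_mpoly; have [->|nz] := eqVneq (f@_(mn2 a b)) 0.
    by rewrite raddf0 !mul0r.
  have := f3 _ nz; rewrite mn2_x mn2_y (prim_order_dvd eta_prim) => /eqP->.
  by rewrite subrr mulr0 mul0r.
Qed.

Lemma wspecial_terms r (eta : CC) f : (0 < r)%N -> (r.*2.+1).-primitive_root eta ->
  wspecial r.*2.+1 f -> N2 f = (r + 2)%N \/ (r.*2 + 3 <= N2 f)%N.
Proof.
move=> r_gt0 eta_prim [f_line f_ge0 f_inv f0].
(* An even bound on the column indices lets the columns split by parity. *)
have le_M : (msize f <= (msize f).*2)%N by rewrite -addnn leq_addr.
rewrite /N2 (size_msupp_columns le_M).
apply: (nterms_special r_gt0 eta_prim) => [|a b|a b||].
- apply: poly_eq_horner => y.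
  rewrite hornerC -(f_line (1 - y) y) ?subrK //.
  rewrite (meval_grid _ _ (@msize_bound _ f)) (horner_coef_wide _ (size_columns f)).
  rewrite horner_sum big_mkord; apply: eq_bigr => a _.
  rewrite hornerM horner_exp !hornerE (horner_coef_wide (n := msize f)).
    rewrite mulr_suml big_mkord; apply: eq_bigr => b _.
    by rewrite columnsE -mulrA [y ^+ _ * _]mulrC.
  apply/leq_sizeP => b le_b; rewrite columnsE; apply/memN_msupp_eq0/msize_mdeg_ge.
  by rewrite mdeg2 mn2_x mn2_y (leq_trans le_b) ?leq_addl.
- by rewrite columnsE.
- by rewrite columnsE => /f_inv; rewrite mn2_x mn2_y.
- by rewrite columnsE mn2_0.
exact: leq_trans (size_columns f) le_M.
Qed.

Definition weight (m : 'X_{1..2}) : nat := (xexp m + (yexp m).*2)%N.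

Lemma weightD (m1 m2 : 'X_{1..2}) : weight (m1 + m2)%MM = (weight m1 + weight m2)%N.
Proof. by rewrite /weight !mnmDE; lia. Qed.

Lemma mn2D a b a' b' : (mn2 a b + mn2 a' b')%MM = mn2 (a + a') (b + b').
Proof. by apply: mn2P; rewrite mnmDE ?mn2_x ?mn2_y. Qed.

Lemma mcoeffM_neq0 (R : comNzRingType) (p q : {mpoly R[2]}) m : (p * q)@_m != 0 ->
  exists m1 m2, [/\ p@_m1 != 0, q@_m2 != 0 & m = (m1 + m2)%MM].
Proof.
rewrite -mcoeff_msupp => /msuppM_le/allpairsP[[m1 m2] /= [p_m1 q_m2 ->]].
by exists m1, m2; rewrite -!mcoeff_msupp.
Qed.

Lemma mcoeffM_ge0 (R : numDomainType) (p q : {mpoly R[2]}) :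
  (forall m, 0 <= p@_m) -> (forall m, 0 <= q@_m) -> forall m, 0 <= (p * q)@_m.
Proof. by move=> p0 q0 m; rewrite mcoeffM sumr_ge0 // => i _; rewrite mulr_ge0. Qed.

Lemma meval_mn2 (R : comNzRingType) (x y : R) a b :
  ('X_[mn2 a b] : {mpoly R[2]}).@[pt2 x y] = x ^+ a * y ^+ b.
Proof. by rewrite mevalX big_ord_recl big_ord1 /= !mnmE. Qed.

(** * Attained values *)

(** The bivariate Lucas polynomials s^n + t^n, where s + t = x and s t = -y. *)
Fixpoint lucas (n : nat) : {mpoly RR[2]} :=
  if n is n1.+1 then
    if n1 is n2.+1 then 'X_[mn2 1 0] * lucas n1 + 'X_[mn2 0 1] * lucas n2
    else 'X_[mn2 1 0]
  else 2%:R.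

Lemma lucas_ind (P : nat -> {mpoly RR[2]} -> Prop) :
    P 0%N 2%:R -> P 1%N 'X_[mn2 1 0] ->
    (forall n p q, P n p -> P n.+1 q -> P n.+2 ('X_[mn2 1 0] * q + 'X_[mn2 0 1] * p)) ->
  forall n, P n (lucas n).
Proof.
move=> P0 P1 PS n; suff [] : P n (lucas n) /\ P n.+1 (lucas n.+1) by [].
by elim: n => [|n [IHn IHn1]]; split=> //; apply: PS.
Qed.

(** On the line the characteristic polynomial t^2 - x t - y has the roots 1 and -y. *)
Lemma lucas_line n x y : x + y = 1 -> (lucas n).@[pt2 x y] = 1 + (- y) ^+ n.
Proof.
move=> xy1; have -> : x = 1 - y by rewrite -xy1 addrK.
elim/lucas_ind: n / (lucas n) => [||n p q IHp IHq].
- by rewrite rmorph_nat expr0.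
- by rewrite meval_mn2 expr0 mulr1 !expr1.
rewrite mevalD !mevalM !meval_mn2 IHp IHq expr0 expr1 !exprS; ring.
Qed.

Lemma lucas_ge0 n m : 0 <= (lucas n)@_m.
Proof.
move: n m; apply: (lucas_ind (P := fun _ p => forall m, 0 <= p@_m)) => [m|m|n p q p0 q0 m].
- by rewrite -mpolyC_nat mcoeffC mulr_ge0 ?ler0n.
- by rewrite mcoeffX ler0n.
by rewrite mcoeffD addr_ge0 ?mcoeffM_ge0 // => m'; rewrite mcoeffX ler0n.
Qed.

Lemma lucas_weight n m : (lucas n)@_m != 0 -> weight m = n.
Proof.
move: n m; apply: (lucas_ind (P := fun n p => forall m, p@_m != 0 -> weight m = n)).
- move=> m; rewrite -mpolyC_nat mcoeffC; case: (m =P 0%MM) => [->|_]; last by rewrite mulr0 eqxx.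
  by rewrite /weight !mnm0E.
- move=> m; rewrite mcoeffX; case: (_ =P m) => [<-|_]; last by rewrite eqxx.
  by rewrite /weight mn2_x mn2_y.
move=> n p q p_wt q_wt m; rewrite mcoeffD => nz_m.
have [zx|] := eqVneq ('X_[mn2 1 0] * q)@_m 0.
  move: nz_m; rewrite zx add0r => /mcoeffM_neq0[m1 [m2 [+ /p_wt <- ->]]].
  rewrite mcoeffX; case: (_ =P m1) => [<- _|_]; last by rewrite eqxx.
  by rewrite weightD /weight mn2_x mn2_y.
move=> /mcoeffM_neq0[m1 [m2 [+ /q_wt <- ->]]].
rewrite mcoeffX; case: (_ =P m1) => [<- _|_]; last by rewrite eqxx.
by rewrite weightD /weight mn2_x mn2_y.
Qed.

Section Construction.
Variables (r : nat) (eta : CC).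
Hypothesis r_gt0 : (0 < r)%N.
Hypothesis eta_prim : (r.*2.+1).-primitive_root eta.
Let d := r.*2.+1.

(** The exponent is odd, so the added power of y cancels the term (-y)^d of the Lucas polynomial on
    the line. *)
Definition Phi : {mpoly RR[2]} := lucas r.*2.+1 + 'X_[mn2 0 r.*2.+1].

Lemma Phi_ge0 m : 0 <= Phi@_m.
Proof. by rewrite mcoeffD addr_ge0 ?lucas_ge0 // mcoeffX ler0n. Qed.

Lemma Phi_supp m : Phi@_m != 0 -> m = mn2 0 d \/ weight m = d.
Proof.
rewrite mcoeffD mcoeffX; case: (_ =P m) => [<-|_]; first by left.
by rewrite addr0 => /lucas_weight; right.
Qed.

Lemma Phi_wspecial : wspecial d Phi.
Proof.
split=> [x y xy1|m|m /Phi_supp[->|]|].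
- rewrite mevalD meval_mn2 (lucas_line _ xy1) expr0 mul1r.
  by rewrite exprNn -signr_odd /= odd_double expr1 mulN1r subrK.
- exact: Phi_ge0.
- by rewrite mn2_x mn2_y add0n -muln2 dvdn_mulr.
- by rewrite /weight => ->.
apply/eqP; apply: contraT => /Phi_supp[/mnmP/(_ ord_max)|].
  by rewrite mnm0E mn2_y.
by rewrite /weight !mnm0E.
Qed.

Let mono (j : nat) := mn2 (d - j.*2) j.

(** Weight considerations leave only r + 2 candidate monomials, and the lower bound already proved
    forces all of them to occur; no coefficient has to be computed. *)
Lemma Phi_msupp : size (msupp Phi) = (r + 2)%N /\
  msupp Phi =i mn2 0 d :: [seq mono j | j <- iota 0 r.+1].
Proof.
have sub : {subset msupp Phi <= mn2 0 d :: [seq mono j | j <- iota 0 r.+1]}.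
  move=> m; rewrite mcoeff_msupp inE => /Phi_supp[->|wt_m]; first by rewrite eqxx.
  apply/orP; right; apply/mapP; exists (yexp m); move: wt_m; rewrite /weight.
    by rewrite mem_iota /d; lia.
  by move=> wt_m; apply: mn2P; rewrite ?mn2_x ?mn2_y //; rewrite -wt_m addnK.
have le_sz := uniq_leq_size (msupp_uniq _) sub.
have sz_Phi : size (msupp Phi) = (r + 2)%N.
  have [] := wspecial_terms r_gt0 eta_prim Phi_wspecial; rewrite /N2 // => ge_Phi.
  by move: le_sz; rewrite /= size_map size_iota; lia.
split=> //; apply: (uniq_min_size (msupp_uniq _) sub _).2.
by rewrite sz_Phi /= size_map size_iota; lia.
Qed.

Definition tensor (f Q : {mpoly RR[2]}) : {mpoly RR[2]} := f - Q + Q * Phi.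

(** [Phi] is 1 on the line. The bounds on [Q] keep f - Q non-negative and put the monomials of [Q]
    among those of [f], so that invariance passes to [Q * Phi]. *)
Lemma tensor_wspecial f Q : wspecial d f -> (forall m, 0 <= Q@_m <= f@_m) -> wspecial d (tensor f Q).
Proof.
move=> [f1 f2 f3 f4] Qf.
have Q_ge0 m : 0 <= Q@_m by case/andP: (Qf m).
have [P1 P2 P3 P4] := Phi_wspecial.
have Q_neq0 m : Q@_m != 0 -> f@_m != 0.
  by apply: contra_neq => f0; apply/eqP; rewrite eq_le Q_ge0 andbT -f0; case/andP: (Qf m).
split=> [x y xy1|m|m|].
- by rewrite mevalD mevalB mevalM f1 // P1 // mulr1 subrK.
- by rewrite mcoeffD mcoeffB addr_ge0 ?mcoeffM_ge0 // subr_ge0; case/andP: (Qf m).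
- rewrite mcoeffD mcoeffB; have [QP0|/mcoeffM_neq0[m1 [m2 [/Q_neq0/f3 nz1 /P3 nz2 ->]]]] := eqVneq (Q * Phi)@_m 0.
    rewrite QP0 addr0 => nz_m; apply: f3; apply: contraNneq nz_m => fm0.
    by have := Qf m; rewrite fm0 -eq_le => /eqP<-; rewrite subrr.
  by rewrite !mnmDE doubleD addnACA dvdn_add.
have Q0 : Q@_0%MM = 0 by apply/eqP; apply: contraT => /Q_neq0; rewrite f4 eqxx.
rewrite mcoeffD mcoeffB f4 Q0 subr0 add0r; apply/eqP; apply: contraT.
move=> /mcoeffM_neq0[m1 [m2 [nz1 nz2 /esym/eqP]]].
rewrite -mdeg_eq0 mdegD addn_eq0 !mdeg_eq0 => /andP[/eqP m10 _].
by rewrite m10 Q0 eqxx in nz1.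
Qed.

Lemma wspecial_neq0 f : wspecial d f -> f != 0.
Proof.
case=> f1 _ _ _; apply: contra_eq_neq (f1 1 0 (addr0 _)) => ->.
by rewrite meval0 eq_sym oner_neq0.
Qed.

(* Multiplying a term of maximal degree by [Phi] creates only new monomials. *)
Lemma wspecial_step f : wspecial d f -> exists2 f', wspecial d f' & N2 f' = (N2 f + r.+1)%N.
Proof.
move=> f_sp; have nz_f := wspecial_neq0 f_sp; have [_ f_ge0 _ _] := f_sp.
pose l := mlead f; exists (tensor f (f@_l *: 'X_[l])).
  apply: tensor_wspecial => // m; rewrite mcoeffZ mcoeffX.
  by case: (l =P m) => [<-|_]; rewrite ?mulr1 ?mulr0 ?f_ge0 ?lexx.
have l_f : l \in msupp f by apply: mlead_supp.
have nz_l : f@_l != 0 by rewrite -mcoeff_msupp.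
have supp2 : perm_eq (msupp (f@_l *: 'X_[l] * Phi)) [seq (l + m)%MM | m <- msupp Phi].
  rewrite -scalerAl (perm_trans (msuppZ _ nz_l)) // mulrC; exact: msuppMX.
rewrite /N2 (perm_size (msuppD _)) => [|m]; last first.
  (* A common monomial would be l + m' of degree at most that of l, so m' = 0; but [Phi] has no
     constant term. *)
  apply/negP => /andP[/=]; rewrite (perm_mem (msupp_rem _ _)) (perm_mem supp2).
  move=> /mem_rem fm /mapP[m' Phi_m' Dm]; have := msize_mdeg_lt fm.
  rewrite Dm mdegD -(mlead_deg nz_f) -/l ltnS -[X in (_ <= X)%N]addn0 leq_add2l leqn0.
  rewrite mdeg_eq0 => /eqP m'0; have [_ _ _] := Phi_wspecial.
  by move/eqP; rewrite mcoeff_eq0 -m'0 Phi_m'.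
rewrite size_cat (perm_size (msupp_rem _ _)) (perm_size supp2) size_map Phi_msupp.1.
by rewrite size_rem //; move: l_f; case: (msupp f) => //= *; lia.
Qed.

(** The first s monomials of weight d in [Phi] are multiplied by [Phi]. There remain r + 1 - s
    monomials of weight d and y^d; the products give r + s monomials of weight 2d and s of weight
    3d. *)
Lemma wspecial_base s : (0 < s <= r.+1)%N ->
  exists2 f, wspecial d f & N2 f = (r.*2 + 2 + s)%N.
Proof.
move=> /andP[s_gt0 le_s]; have [szPhi memPhi] := Phi_msupp.
have mono_inj : injective mono by move=> i j /mnmP/(_ ord_max); rewrite !mn2_y.
pose S := [seq mono j | j <- iota 0 s].
pose Q : {mpoly RR[2]} := \sum_(m <- S) Phi@_m *: 'X_[m].
have US : uniq S by rewrite map_inj_uniq ?iota_uniq.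
have QE m : Q@_m = if m \in S then Phi@_m else 0.
  rewrite raddf_sum /=; case: ifPn => [Sm|nSm].
    rewrite (bigD1_seq m) //= mcoeffZ mcoeffX eqxx mulr1 big1 ?addr0 // => m' /negPf ne.
    by rewrite mcoeffZ mcoeffX ne mulr0.
  rewrite big_seq big1 // => m' Sm'; rewrite mcoeffZ mcoeffX.
  by case: (m' =P m) => [Dm|_]; [rewrite Dm (negPf nSm) in Sm'|rewrite mulr0].
have Q_le m : 0 <= Q@_m <= Phi@_m.
  by rewrite QE; case: ifP; rewrite ?Phi_ge0 ?lexx.
exists (tensor Phi Q); first exact: tensor_wspecial Phi_wspecial Q_le.
(* Non-negative coefficients cannot cancel, so the support is the union of the translates. *)
have QPhi m : ((Q * Phi)@_m != 0) = has (fun j => m \in [seq (mono j + m')%MM | m' <- msupp Phi]) (iota 0 s).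
  rewrite mulr_suml raddf_sum /= big_map psumr_neq0 => [|j _]; last first.
    by rewrite -scalerAl mcoeffZ mulr_ge0 ?Phi_ge0 ?mcoeffM_ge0 // => m'; rewrite ?Phi_ge0 // mcoeffX ler0n.
  apply: eq_in_has => j; rewrite mem_iota add0n => /andP[_ lt_js] /=.
  have nz_j : Phi@_(mono j) != 0.
    rewrite -mcoeff_msupp memPhi inE map_f ?orbT // mem_iota; lia.
  rewrite -(perm_mem (msuppMX _ _)) mcoeff_msupp -scalerAl mcoeffZ mulrC [_ * Phi]mulrC.
  have PX_ge0 : 0 <= (Phi * 'X_[mono j])@_m.
    by apply: mcoeffM_ge0 => m'; rewrite ?Phi_ge0 // mcoeffX ler0n.
  by rewrite pmulr_lgt0 ?lt_neqAle ?Phi_ge0 ?PX_ge0 1?eq_sym ?nz_j ?andbT.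
(* [A], [B] and [C] have weights d, 2d and 3d. Only y^d shares its weight, with [B], where the
   exponent of y stays below r + s <= d. *)
pose A := [seq mono j | j <- iota s (r.+1 - s)].
pose B := [seq mn2 (d.*2 - k.*2) k | k <- iota 0 (r + s)].
pose C := [seq mn2 (d - j.*2) (d + j) | j <- iota 0 s].
have wA m : m \in A -> weight m = d.
  by case/mapP=> j; rewrite mem_iota /weight => lt_j ->; rewrite mn2_x mn2_y /d; lia.
have wB m : m \in B -> weight m = d.*2 /\ yexp m <> d.
  by case/mapP=> j; rewrite mem_iota /weight => lt_j ->; rewrite mn2_x mn2_y /d; lia.
have wC m : m \in C -> weight m = (3 * d)%N.
  by case/mapP=> j; rewrite mem_iota /weight => lt_j ->; rewrite mn2_x mn2_y /d; lia.
have wy : weight (mn2 0 d) = d.*2 by rewrite /weight mn2_x mn2_y.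
have -> : (r.*2 + 2 + s)%N = size (A ++ mn2 0 d :: B ++ C).
  by rewrite size_cat /= size_cat !size_map !size_iota; lia.
rewrite /N2; apply/perm_size/uniq_perm; rewrite ?msupp_uniq //.
  have UA : uniq A by rewrite map_inj_uniq ?iota_uniq.
  have UB : uniq B.
    by rewrite map_inj_uniq ?iota_uniq // => i j /mnmP/(_ ord_max); rewrite !mn2_y.
  have UC : uniq C.
    by rewrite map_inj_uniq ?iota_uniq // => i j /mnmP/(_ ord_max); rewrite !mn2_y => /addnI.
  rewrite cat_uniq UA /= cat_uniq UB UC mem_cat !andbT /=; apply/and3P; split.
  - apply/norP; split; first by apply/negP=> /wA; rewrite wy /d; lia.
    apply/hasPn=> m; rewrite mem_cat => /orP[/wB[wm _]|/wC wm]; apply/negP=> /wA; rewrite wm /d; lia.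
  - apply/norP; split; first by apply/negP=> /wB[_]; rewrite mn2_y.
    by apply/negP=> /wC; rewrite wy /d; lia.
  by apply/hasPn=> m /wC wm; apply/negP=> /wB[]; rewrite wm /d; lia.
move=> m; rewrite mcoeff_msupp mcoeffD mcoeffB.
have [Q_ge0 Q_lePhi] := andP (Q_le m).
rewrite paddr_eq0 ?subr_ge0 ?mcoeffM_ge0 //; first last.
- exact: Phi_ge0.
- by move=> m'; case/andP: (Q_le m').
rewrite negb_and QPhi; have -> : (Phi@_m - Q@_m != 0) = (m \notin S) && (m \in msupp Phi).
  by rewrite QE mcoeff_msupp; case: (m \in S); rewrite ?subrr ?eqxx ?subr0.
rewrite memPhi in_cons mem_cat [m \in _ :: (_ ++ _)]in_cons mem_cat; apply/idP/idP.
  case/orP=> [/andP[nSm /orP[->|/mapP[j j_le Dm]]]|/hasP[j j_lt /mapP[m' + ->]]].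
  - by rewrite !orbT.
  - rewrite Dm map_f //; move: j_le nSm; rewrite !mem_iota Dm mem_map // mem_iota; lia.
  rewrite memPhi inE => /orP[/eqP->|/mapP[i i_le ->]]; rewrite mn2D.
    by rewrite addn0 addnC; apply/orP; right; apply/orP; right; apply/orP; right; apply: map_f.
  apply/orP; right; apply/orP; right; apply/orP; left; apply/mapP; exists (j + i)%N.
    by move: i_le j_lt; rewrite !mem_iota; lia.
  by move: i_le j_lt; rewrite !mem_iota => i_le j_lt; congr mn2; rewrite /d; lia.
case/or4P=> [/mapP[j j_s ->]|/eqP->|/mapP[k k_lt ->]|/mapP[j j_lt ->]]; apply/orP.
- left; apply/andP; split; last first.
    by rewrite map_f ?orbT // mem_iota; move: j_s; rewrite mem_iota; lia.
  by rewrite mem_map // mem_iota; move: j_s; rewrite mem_iota; lia.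
- left; rewrite eqxx andbT; apply/negP=> /mapP[j j_lt /(congr1 weight)].
  by rewrite wy /weight mn2_x mn2_y; move: j_lt; rewrite mem_iota /d; lia.
(* This splits k < r + s as j + i with j < s and i <= r. *)
- right; apply/hasP; exists (minn k s.-1); first by rewrite mem_iota; lia.
  apply/mapP; exists (mono (k - minn k s.-1)%N).
    by rewrite memPhi inE map_f ?orbT // mem_iota; move: k_lt; rewrite mem_iota; lia.
  by rewrite mn2D; congr mn2; move: k_lt; rewrite mem_iota /d; lia.
right; apply/hasP; exists j => //; apply/mapP; exists (mn2 0 d).
  by rewrite memPhi inE eqxx.
by rewrite mn2D addn0 addnC.
Qed.

Lemma wspecial_exists n : (n = r + 2 \/ r.*2 + 3 <= n)%N ->
  exists2 f, wspecial d f & N2 f = n.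
Proof.
case=> [->|]; first by exists Phi; [exact: Phi_wspecial|exact: Phi_msupp.1].
have [k] := ubnP n; elim: k n => // k IHk n /ltnSE le_nk le_n.
(* The values 2r + 3, ..., 3r + 3 are r + 1 consecutive integers, so steps of r + 1 from them reach
   everything above. *)
have [le_n3|lt_n3] := leqP n (3 * r + 3).
  have [|f f_sp Nf] := @wspecial_base (n - (r.*2 + 2)); first by lia.
  by exists f => //; rewrite Nf subnKC //; lia.
have [||f f_sp Nf] := IHk (n - r.+1)%N; [lia|lia|].
by have [f' f'_sp Nf'] := wspecial_step f_sp; exists f' => //; rewrite Nf' Nf subnK //; lia.
Qed.
End Construction.

(** * The one-variable case *)

Lemma special1_exists m (eta : CC) n : (0 < m)%N -> eta ^+ m = 1 -> (0 < n)%N ->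
  exists f : {poly RR}, special1 eta f /\ N1 f = n.
Proof.
move=> m_gt0 eta_m n_gt0; have nz_n : n%:R != 0 :> RR by rewrite pnatr_eq0 -lt0n.
(* The witness [f n] is the average of x^m, ..., x^(mn). The number of summands is a separate
   parameter, so that terms can be counted by induction with the coefficient fixed. *)
pose f k : {poly RR} := \sum_(0 <= i < k) n%:R^-1 *: 'X^(m * i.+1).
exists (f n); split; last first.
  suff: forall k, nterms (f k) = k by apply.
  elim=> [|k IHk]; first by rewrite /f big_geq // /nterms polyseq0.
  rewrite /f big_nat_recr //= nterms_addXn ?invr_eq0 ?IHk //.
  rewrite coef_sum big_nat big1 // => i /andP[_ lt_ik]; rewrite coefZ coefXn.
  by rewrite eqn_pmul2l // eqSS gtn_eqF ?mulr0.
split=> [z||i|].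
- rewrite /Defs.polyC1 rmorph_sum !horner_sum; apply: eq_bigr => i _ /=.
  by rewrite map_polyZ map_polyXn !hornerZ !hornerXn exprMn exprM eta_m expr1n mul1r.
- rewrite horner_sum (eq_bigr (fun=> n%:R^-1)) => [|i _]; last by rewrite hornerZ hornerXn expr1n mulr1.
  by rewrite big_const_nat subn0 iter_addr_0 -[LHS]mulr_natr mulVf.
- by rewrite coef_sum sumr_ge0 // => j _; rewrite coefZ coefXn mulr_ge0 ?invr_ge0 ?ler0n.
rewrite horner_sum big1 // => i _.
by rewrite hornerZ hornerXn expr0n muln_eq0 -leqn0 leqNgt m_gt0 mulr0.
Qed.

Theorem theorem1p2 :
  (forall (m : nat), (2 <= m)%N ->
   forall eta : CC, m.-primitive_root eta ->
   forall n : nat, (exists f : {poly RR}, special1 eta f /\ N1 f = n) <-> (0 < n)%N)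
  /\
  (forall (r : nat), (1 <= r)%N ->
   forall eta : CC, (r.*2.+1).-primitive_root eta ->
   forall n : nat, (exists f : {mpoly RR[2]}, special2 eta f /\ N2 f = n) <->
                   (n = r + 2 \/ r.*2 + 3 <= n)%N).
Proof.
split=> [m m_ge2 eta eta_prim n|r r_gt0 eta eta_prim n]; split.
- move=> [f [[_ f1 _ _] <-]]; rewrite [N1 f]/(nterms f) nterms_gt0.
  by apply: contra_eq_neq f1 => ->; rewrite horner0 eq_sym oner_neq0.
- by apply: special1_exists (prim_expr_order eta_prim); apply: ltnW.
- by move=> [f [/(special2P _ eta_prim) f_sp <-]]; apply: wspecial_terms eta_prim f_sp.
move/(wspecial_exists r_gt0 eta_prim) => [f f_sp Nf].
by exists f; split=> //; apply/(special2P _ eta_prim).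
Qed.
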